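(* Let $\nu \in (0,1)$ and $\lambda,\kappa>0$ be such that $6\kappa+\lambda<\nu$. Then there is a subspace $\mathcal{C}\subset(\mathbb{C}^2)^{\otimes n}$ spanned by descendant states $\{S_-^r|\Psi\rangle\}_r$ with magnetizations $r$ pairwise differing by at least $2$ such that $\mathcal{C}$ is an $(\epsilon,\delta)[[n,k,d]]$-AQEDC with parameters \[ k=\kappa \log_2 n,\qquad d=n^{1-\nu},\qquad \epsilon =\Theta(n^{-(\nu-(6\kappa+\lambda))}),\qquad \delta=n^{-\lambda}. \]
   Context: On $n$ qubits, let $\omega=e^{2\pi i/n}$, $\sigma_m^-=|0\rangle\langle1|$ on qubit $m$, $S_-=\sum_{m=1}^n\sigma^-_m$, and $|\Psi\rangle=\overline{\omega}\sum_{m=1}^n\omega^m\sigma_m^-|1\rangle^{\otimes n}$ (the one-magnon, momentum-$2\pi/n$ low-energy eigenstate of the periodic Heisenberg XXX chain $H=-\frac14\sum_m(\sigma^x_m\sigma^x_{m+1}+\sigma^y_m\sigma^y_{m+1}+\sigma^z_m\sigma^z_{m+1})$); its descendants $S_-^r|\Psi\rangle$, $r=0,\dots,n-2$, have magnetization indexed by $r$. A $d$-local operator acts as $F_S\otimes I$ on some set $S$ of $d$ (not necessarily contiguous) qubits. A subspace $\mathcal{C}$ with projection $P$ is an $(\epsilon,\delta)$-approximate error-detection code for a CPTP map $\mathcal{N}$ if for every unit $|\Phi\rangle\in\mathcal{C}$ with $\mathrm{tr}(P\mathcal{N}(|\Phi\rangle\langle\Phi|))\ge\delta$ one has $\langle\Phi|\rho_{\mathcal{N},P}|\Phi\rangle\ge1-\epsilon$,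 where $\rho_{\mathcal{N},P}=\mathrm{tr}(P\mathcal{N}(|\Phi\rangle\langle\Phi|))^{-1}P\mathcal{N}(|\Phi\rangle\langle\Phi|)P$. An $(\epsilon,\delta)[[n,k,d]]$-AQEDC is a $2^k$-dimensional subspace that is an $(\epsilon,\delta)$-approximate error-detection code for every CPTP map $\mathcal{N}(\rho)=\sum_jp_jF_j\rho F_j^\dagger$ with each $F_j$ $d$-local, $\|F_j\|\le1$, and $\{p_j\}$ a probability distribution. *)

(* Defs.v *)
From mathcomp Require Import all_boot all_order all_algebra.
From mathcomp Require Import complex.
From mathcomp Require Import reals exp trigo.
Unset Printing Implicit Defensive.
Import Order.TTheory GRing.Theory Num.Theory.
Local Open Scope ring_scope.
Local Open Scope complex_scope.

Section QuantumDefs.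
Variable R : realType.
Local Notation C := R[i].

Definition basis (n : nat) := {ffun 'I_n -> bool}.
Definition qstate (n : nat) := basis n -> C.
Definition qop (n : nat) := basis n -> basis n -> C.

Definition opapp n (F : qop n) (v : qstate n) : qstate n :=
  fun x => \sum_(y : basis n) F x y * v y.
Definition opmul n (F G : qop n) : qop n :=
  fun x z => \sum_(y : basis n) F x y * G y z.
Definition adj n (F : qop n) : qop n := fun x y => (F y x)^*.
Definition idop n : qop n := fun x y => if x == y then 1 else 0.
Definition dinner n (u v : qstate n) : C := \sum_(x : basis n) (u x)^* * v x.
Definition trace n (F : qop n) : C := \sum_(x : basis n) F x x.
Definition ketbra n (u v : qstate n) : qop n := fun x y => u x * (v y)^*.

Definition opnorm_le1 n (F : qop n) : Prop :=
  forall v : qstate n, dinner n (opapp n F v) (opapp n F v) <= dinner n v v.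

(* sigma^-_m = |0><1| acting on qubit m (tensored with identity) *)
Definition sigma_minus n (m : 'I_n) : qop n :=
  fun x y => if [&& y m, ~~ x m & [forall i, (i != m) ==> (x i == y i)]]
             then 1 else 0.
Definition S_minus n : qop n := fun x y => \sum_(m < n) sigma_minus n m x y.
Definition all_ones n : qstate n := fun x => if x == [ffun => true] then 1 else 0.
Definition omega n : C := cos (2 * pi / n%:R) +i* sin (2 * pi / n%:R).
(* |Psi> = conj(omega) sum_{m=1}^n omega^m sigma^-_m |1...1>
   (qubit m = 1..n is the ordinal m-1 : 'I_n) *)
Definition Psi n : qstate n :=
  fun x => (omega n)^* *
    \sum_(m < n) (omega n) ^+ m.+1 * opapp n (sigma_minus n m) (all_ones n) x.
Definition descendant n (r : nat) : qstate n := iter r (opapp n (S_minus n)) (Psi n).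

Definition in_desc_span n (Rs : {set 'I_n.-1}) (v : qstate n) : Prop :=
  exists c : 'I_n.-1 -> C,
    forall x, v x = \sum_(r in Rs) c r * descendant n r x.
Definition desc_lin_indep n (Rs : {set 'I_n.-1}) : Prop :=
  forall c : 'I_n.-1 -> C,
    (forall x, \sum_(r in Rs) c r * descendant n r x = 0) ->
    forall r, r \in Rs -> c r = 0.
Definition mag_sep2 n (Rs : {set 'I_n.-1}) : Prop :=
  forall r r' : 'I_n.-1, r \in Rs -> r' \in Rs -> r != r' ->
    (r + 2 <= r')%N \/ (r' + 2 <= r)%N.

Definition is_orth_proj_onto n (V : qstate n -> Prop) (P : qop n) : Prop :=
  [/\ forall x y, opmul n P P x y = P x y,
      forall x y, adj n P x y = P x y,
      forall v, V (opapp n P v)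
    & forall v, V v -> forall x, opapp n P v x = v x].

(* F is d-local: F = F_S (x) I for a set S of d qubits *)
Definition d_local n (d : nat) (F : qop n) : Prop :=
  exists S : {set 'I_n}, #|S| = d /\
  exists G : qop n,
    (forall x y x' y' : basis n, (forall i, i \in S -> x i = x' i /\ y i = y' i) ->
        G x y = G x' y') /\
    (forall x y, F x y = if [forall i, (i \notin S) ==> (x i == y i)]
                         then G x y else 0).

Definition channel n (J : finType) (p : J -> R) (F : J -> qop n) (rho : qop n)
  : qop n :=
  fun x y => \sum_(j : J) (p j)%:C * opmul n (opmul n (F j) rho) (adj n (F j)) x y.

Definition approx_error_detect n (V : qstate n -> Prop) (P : qop n)
  (J : finType) (p : J -> R) (F : J -> qop n) (eps delta : R) : Prop :=
  forall Phi : qstate n, V Phi -> dinner n Phi Phi = 1 ->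
    let NPhi := channel n J p F (ketbra n Phi Phi) in
    let t := trace n (opmul n P NPhi) in
    delta%:C <= t ->
    let rhoNP : qop n := fun x y => t^-1 * opmul n (opmul n P NPhi) P x y in
    (1 - eps)%:C <= dinner n Phi (opapp n rhoNP Phi).

Definition desc_AQEDC n (k d : nat) (eps delta : R) (Rs : {set 'I_n.-1}) : Prop :=
  [/\ #|Rs| = (2 ^ k)%N,           (* dim = 2^k: the spanning family is a basis *)
      desc_lin_indep n Rs
    & forall P : qop n, is_orth_proj_onto n (in_desc_span n Rs) P ->
      forall (J : finType) (p : J -> R) (F : J -> qop n),
        (forall j, 0 <= p j) -> \sum_(j : J) p j = 1 ->
        (forall j, d_local n d (F j)) -> (forall j, opnorm_le1 n (F j)) ->
        (forall x y, \sum_(j : J) (p j)%:C * opmul n (adj n (F j)) (F j) x y = idop n x y) ->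
        approx_error_detect n (in_desc_span n Rs) P J p F eps delta].

Definition log2 (x : R) : R := ln x / ln 2.

End QuantumDefs.

(* Main.v *)
Require Import Defs.
From mathcomp Require Import all_boot all_order all_algebra.
From mathcomp Require Import complex.
From mathcomp Require Import reals exp trigo.
From mathcomp Require Import boolp ring lra zify.
Import Order.TTheory GRing.Theory Num.Theory.
Local Open Scope ring_scope.

(** The code is spanned by the descendants of even index [r < 2 * 2^k].  In the
    computational basis they are supported on strings with at most
    [M = 2 * 2^k] zeros, and cyclic translation multiplies every descendant by
    the same phase.  Hence a code state has the same probability of a zero at
    each site, at most [M / n], and the probability of a zero among [d] given
    sites is at most [Q = d M / n <= 2 n^(kappa - nu)].  Up to this small
    weight, a local operator [F] acts on the code as its matrix element [f] on
    the all-ones configuration, so [|P F Phi - f Phi|^2 <= 12 Q] with [P] the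
    code projection; averaging over the Kraus operators bounds
    [tr (P N(Phi)) - <Phi|N(Phi)|Phi>] by [12 Q], and dividing by a trace
    [>= delta] gives [eps = 12 Q / delta]. *)

(** * Basis strings, their sets of zeros, and cyclic translation *)

Section Configurations.
Variable n : nat.
Implicit Types (x y : basis n) (m i : 'I_n).

(** The all-ones string acts as a vacuum and each [sigma_minus] creates a zero, so strings are
    tracked by their zeros. *)
Definition zeros x : {set 'I_n} := [set m | ~~ x m].
Definition fill x m : basis n := [ffun i => (i == m) || x i].
Definition shift x : basis n := [ffun i => x (ord_pred i)].

Lemma zeros_inj : injective zeros.
Proof.
move=> x y /setP e; apply/ffunP => i.
by have := e i; rewrite !inE => /negb_inj.
Qed.

Lemma zeros_surj (Z : {set 'I_n}) : exists x, zeros x = Z.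
Proof.
exists [ffun i => i \notin Z]; apply/setP => i.
by rewrite !inE ffunE negbK.
Qed.

Lemma zeros_fill x m : zeros (fill x m) = zeros x :\ m.
Proof. by apply/setP => i; rewrite !inE ffunE negb_or. Qed.

Lemma zeros_ones : zeros [ffun => true] = set0.
Proof. by apply/setP => i; rewrite !inE ffunE. Qed.

Lemma zeros_shift x : zeros (shift x) = @ordS n @: zeros x.
Proof.
apply/setP => i; rewrite -[i in RHS]ord_predK.
by rewrite mem_imset ?inE ?ffunE //; exact: ordS_inj.
Qed.

Lemma shift_bij : bijective shift.
Proof.
apply: injF_bij => x y /ffunP e; apply/ffunP => i.
by have := e (ordS i); rewrite !ffunE ordSK.
Qed.

Lemma sigma_minusE (R : realType) m x y :
  sigma_minus R n m x y = ((~~ x m) && (y == fill x m))%:R.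
Proof.
rewrite /sigma_minus; set b := [&& _, _ & _].
suff -> : b = ~~ x m && (y == fill x m) by case: ifP.
rewrite /b; apply/idP/idP => [/and3P[ym xm /forallP xy]|/andP[xm /eqP ->]].
  rewrite xm; apply/eqP/ffunP => i; rewrite ffunE.
  have := xy i; case: (eqVneq i m) => [-> _|_ /= /eqP ->] //=.
rewrite ffunE eqxx xm /=; apply/forallP => i; apply/implyP => im.
by rewrite ffunE (negPf im).
Qed.

End Configurations.

(** * Amplitudes of the descendants: closed form, translation phase, non-vanishing *)

Section Descendants.
Variables (R : realType) (n : nat).
Local Notation C := R[i].
Local Notation w := (omega R n).
Implicit Types x : basis n.

Definition wsum (Z : {set 'I_n}) : C := \sum_(m in Z) w ^+ m.+1.

Lemma sigma_minus_app m (v : qstate R n) x :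
  opapp R n (sigma_minus R n m) v x = if x m then 0 else v (fill n x m).
Proof.
rewrite /opapp (bigD1 (fill n x m)) //= sigma_minusE eqxx andbT.
rewrite big1 ?addr0 => [|y /negPf yx]; last by rewrite sigma_minusE yx andbF mul0r.
by case: (x m); rewrite ?mul0r ?mul1r.
Qed.

Lemma S_minus_app (v : qstate R n) x :
  opapp R n (S_minus R n) v x = \sum_(m in zeros n x) v (fill n x m).
Proof.
transitivity (\sum_(m < n) opapp R n (sigma_minus R n m) v x).
  rewrite /opapp /S_minus; under eq_bigr do rewrite mulr_suml.
  by rewrite exchange_big.
rewrite [RHS]big_mkcond; apply: eq_bigr => m _.
by rewrite sigma_minus_app inE; case: (x m).
Qed.

Lemma PsiE x :
  Psi R n x = if #|zeros n x| == 1 then (w^*)%C * wsum (zeros n x) else 0.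
Proof.
rewrite /Psi.
have aux m : opapp R n (sigma_minus R n m) (all_ones R n) x =
    if (m \in zeros n x) && (#|zeros n x| == 1) then 1 else 0.
  rewrite sigma_minus_app inE; case xm: (x m) => //=.
  rewrite /all_ones -(inj_eq (@zeros_inj n)) zeros_fill zeros_ones -cards_eq0.
  by rewrite (cardsD1 m (zeros n x)) inE xm /= add1n eqSS.
under eq_bigr do rewrite aux.
case: ifP => c; last by rewrite big1 ?mulr0 // => m _; rewrite andbF mulr0.
congr (_ * _); rewrite /wsum [RHS]big_mkcond; apply: eq_bigr => m _.
by rewrite andbT; case: ifP; rewrite ?mulr1 ?mulr0.
Qed.

Lemma wsumD1 (Z : {set 'I_n}) m : m \in Z -> wsum (Z :\ m) = wsum Z - w ^+ m.+1.
Proof. by move=> mZ; rewrite /wsum (big_setD1 m mZ) /= [_ ^+ _ + _]addrC addrK. Qed.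

(** [S_minus] sums over the zero [m] created last. For a set [Z] of [r+2] zeros, the sum of
    [wsum (Z :\ m)] over [m] in [Z] is [(r+2) wsum Z - wsum Z], and the resulting factors [r+1]
    build up the factorial. *)
Lemma descendantE r x :
  descendant R n r x =
  if #|zeros n x| == r.+1 then r`!%:R * (w^*)%C * wsum (zeros n x) else 0.
Proof.
elim: r x => [|r IH] x; first by rewrite /descendant /= PsiE fact0 mul1r.
rewrite /descendant iterS -/(descendant R n r) S_minus_app.
rewrite (eq_bigr (fun m : 'I_n => if #|zeros n x| == r.+2 then
    r`!%:R * (w^*)%C * (wsum (zeros n x) - w ^+ m.+1) else 0)); last first.
  move=> m mx; rewrite IH zeros_fill wsumD1 //.
  by rewrite (cardsD1 m (zeros n x)) mx add1n eqSS.
case: eqP => [c|_]; last by rewrite big1.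
rewrite -mulr_sumr sumrB -/(wsum _) sumr_const c factS natrM mulrS.
by rewrite addrAC subrr add0r -mulr_natl; ring.
Qed.

Lemma omega_expr k : w ^+ k =
  (cos ((2 * pi / n%:R) *+ k) +i* sin ((2 * pi / n%:R) *+ k))%C.
Proof.
elim: k => [|k IH]; first by rewrite mulr0n cos0 sin0 expr0.
rewrite exprS IH (mulrS (_ / _)) cosD sinD /omega.
by apply/eqP; rewrite eq_complex /= eqxx /= [X in _ == X]addrC.
Qed.

Lemma omega_unity : (0 < n)%N -> w ^+ n = 1.
Proof.
move=> n0; rewrite omega_expr -mulr_natr divfK ?pnatr_eq0 -?lt0n //.
by rewrite -[2 * pi]add0r mulr_natl cosD2pi sinD2pi cos0 sin0.
Qed.

Lemma omega_neq1 : (2 < n)%N -> w != 1.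
Proof.
move=> n2; rewrite eq_complex negb_and /=; apply/orP; right.
have n0 : 0 < n%:R :> R by rewrite ltr0n (ltn_trans _ n2).
have n3 : 3 <= n%:R :> R by rewrite (ler_nat R 3).
have p0 := pi_gt0 R.
rewrite gt_eqF // sin_gt0_pi // divr_gt0 ?mulr_gt0 //=.
by rewrite ltr_pdivrMr // mulrC; nra.
Qed.

Lemma omega_conj : w * (w^*)%C = 1.
Proof.
apply/eqP; rewrite eq_complex /=; apply/andP; split; apply/eqP.
  by rewrite mulrN opprK -!expr2 cos2Dsin2.
by rewrite mulrN mulrC addNr.
Qed.

Lemma wsum_shift (Z : {set 'I_n}) : wsum (@ordS n @: Z) = w * wsum Z.
Proof.
rewrite /wsum big_imset /=; last by move=> i j _ _; exact: ordS_inj.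
rewrite mulr_sumr; apply: eq_bigr => m _.
rewrite exprS; congr (_ * _).
(* The last site wraps to site 0; reducing the exponent modulo [n] is harmless because
   [w ^+ n = 1]. *)
by rewrite expr_mod // omega_unity // (leq_trans _ (ltn_ord m)).
Qed.

Lemma descendant_shift r x : descendant R n r (shift n x) = w * descendant R n r x.
Proof.
rewrite !descendantE zeros_shift card_imset; last exact: ordS_inj.
by rewrite wsum_shift; case: ifP => _; [ring | rewrite mulr0].
Qed.

(** Take the first [r+2] sites and remove either site 0 or site 1. The two values of [wsum] differ
    by [w - w^2], nonzero for [n > 2], so at least one of these sets of [r+1] zeros has nonzero
    amplitude. *)
Lemma descendant_neq0 r : (2 < n)%N -> (r.+1 < n)%N ->
  exists x, #|zeros n x| = r.+1 /\ descendant R n r x != 0.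
Proof.
move=> n2 rn.
have w0 : w != 0.
  by apply/eqP => w0; have /eqP := omega_conj; rewrite w0 mul0r eq_sym oner_eq0.
pose U := [set widen_ord rn j | j in [set: 'I_r.+2]].
have cU : #|U| = r.+2.
  rewrite card_imset ?cardsT ?card_ord // => i j /(congr1 val) /= ij.
  exact: val_inj.
have inU j : widen_ord rn j \in U by apply: imset_f; rewrite inE.
have cD j : #|U :\ widen_ord rn j| = r.+1.
  by have := cardsD1 (widen_ord rn j) U; rewrite cU inU add1n => -[].
have [j wj] : exists j, wsum (U :\ widen_ord rn j) != 0.
  have [w00|] := eqVneq (wsum (U :\ widen_ord rn ord0)) 0; last by exists ord0.
  exists (lift ord0 ord0); apply/eqP => w10.
  move: w00 w10; rewrite !wsumD1 // => /eqP + /eqP; rewrite !subr_eq add0r.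
  move=> /eqP -> /eqP /=; rewrite add0r expr1 expr2 => ww.
  by move: (omega_neq1 n2); rewrite -(inj_eq (mulfI w0)) mulr1 -ww eqxx.
have [x zx] := zeros_surj n (U :\ widen_ord rn j).
exists x; rewrite descendantE zx cD eqxx; split=> //.
rewrite !mulf_neq0 ?pnatr_eq0 -?lt0n ?fact_gt0 //.
by apply: contraNneq w0 => wc; have := omega_conj;
  rewrite wc mulr0 => /eqP; rewrite eq_sym oner_eq0.
Qed.

End Descendants.

(** * Inner products and squared norms *)

Section InnerProduct.
Variables (R : realType) (n : nat).
Local Notation C := R[i].
Local Notation dot := (dinner R n).
Local Notation app := (opapp R n).
Local Notation Re := complex.Re.
Local Notation Im := complex.Im.
Implicit Types (u v : qstate R n) (F G P : qop R n) (z : C).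

(** Squared modulus with values in [R] rather than [R[i]], so that the estimates become real
    inequalities. *)
Definition normsq z : R := Re z ^+ 2 + Im z ^+ 2.
Definition nrm2 u : R := \sum_x normsq (u x).

Lemma normsqE z : (normsq z)%:C%C = conjc z * z.
Proof.
by case: z => a b; apply/eqP; rewrite eq_complex /normsq /=; apply/andP; split; apply/eqP; ring.
Qed.

Lemma normsq_ge0 z : 0 <= normsq z.
Proof. by rewrite /normsq addr_ge0 ?sqr_ge0. Qed.

Lemma normsqM z1 z2 : normsq (z1 * z2) = normsq z1 * normsq z2.
Proof. by case: z1 z2 => a b [c d]; rewrite /normsq /=; ring. Qed.

Lemma nrm2_ge0 u : 0 <= nrm2 u.
Proof. by apply: sumr_ge0 => x _; exact: normsq_ge0. Qed.

Lemma dinnerE u v : dot u v = \sum_x conjc (u x) * v x.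
Proof. by []. Qed.

Lemma dotE u : dot u u = (nrm2 u)%:C%C.
Proof.
rewrite dinnerE /nrm2 (raddf_sum (real_complex R)) /=.
by apply: eq_bigr => x _; rewrite normsqE.
Qed.

Lemma nrm2E u : nrm2 u = Re (dot u u).
Proof. by rewrite dotE. Qed.

Lemma dot_conj u v : conjc (dot u v) = dot v u.
Proof.
rewrite dinnerE (raddf_sum (@conjc R)) /=; apply: eq_bigr => x _.
by rewrite rmorphM /= conjcK mulrC.
Qed.

Lemma ReD z1 z2 : Re (z1 + z2) = Re z1 + Re z2.
Proof. by case: z1; case: z2. Qed.

Lemma Re_sum (I : finType) (E : I -> C) : Re (\sum_i E i) = \sum_i Re (E i).
Proof. by elim/big_rec2: _ => //= i a b _ <-; rewrite ReD. Qed.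

(** Expand [s |u - v/s|^2 >= 0]. The free weight [s] trades a small [u] against a bounded [v]. *)
Lemma amgm_dot (s : R) u v : 0 < s ->
  2 * Re (dot u v) <= s * nrm2 u + s^-1 * nrm2 v.
Proof.
move=> s0; rewrite !dinnerE Re_sum !mulr_sumr -big_split /=.
apply: ler_sum => x _; case: (u x) (v x) => a b [c d]; rewrite /normsq /=.
have := addr_ge0 (mulr_ge0 (ltW s0) (sqr_ge0 (a - s^-1 * c)))
                 (mulr_ge0 (ltW s0) (sqr_ge0 (b - s^-1 * d))).
rewrite -subr_ge0 => h; rewrite -subr_ge0; apply: le_trans h _.
rewrite le_eqVlt; apply/orP; left; apply/eqP; field.
by rewrite gt_eqF.
Qed.

Lemma dot_appl F u v : dot (app F u) v = dot u (app (adj R n F) v).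
Proof.
rewrite !dinnerE /opapp.
under eq_bigr do rewrite rmorph_sum mulr_suml.
rewrite exchange_big /=; apply: eq_bigr => y _.
rewrite mulr_sumr; apply: eq_bigr => x _.
by rewrite rmorphM /= /adj; ring.
Qed.

Lemma opapp_opmul F G u x : app (opmul R n F G) u x = app F (app G u) x.
Proof.
rewrite /opapp /opmul; under eq_bigr do rewrite mulr_suml.
rewrite exchange_big /=; apply: eq_bigr => y _.
by rewrite mulr_sumr; apply: eq_bigr => z _; rewrite mulrA.
Qed.

Lemma opappB F u v x : app F (fun y => u y - v y) x = app F u x - app F v x.
Proof.
by rewrite /opapp -sumrB; apply: eq_bigr => y _; rewrite mulrBr.
Qed.

Lemma opappZ F z u x : app F (fun y => z * u y) x = z * app F u x.
Proof. by rewrite /opapp mulr_sumr; apply: eq_bigr => y _; ring. Qed.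

Lemma nrm2_app_le F u : opnorm_le1 R n F -> nrm2 (app F u) <= nrm2 u.
Proof. by move=> /(_ u); rewrite !dotE lecR. Qed.

(* [<u,v>] minimises the distance from [v] to the line of the unit vector [u]. *)
Lemma nrm2_sub_proj_le u v z : nrm2 u = 1 ->
  nrm2 v - normsq (dot u v) <= nrm2 (fun x => v x - z * u x).
Proof.
move=> u1.
suff -> : nrm2 (fun x => v x - z * u x) =
          nrm2 v - normsq (dot u v) + normsq (z - dot u v).
  by rewrite lerDl normsq_ge0.
apply: (@complexI R); rewrite rmorphD rmorphB /= !normsqE -!dotE.
have -> : dot (fun x => v x - z * u x) (fun x => v x - z * u x) =
    dot v v - z * dot v u - conjc z * dot u v + conjc z * z * dot u u.
  rewrite !dinnerE !mulr_sumr -!sumrB -big_split /=; apply: eq_bigr => x _.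
  by rewrite !rmorphB !rmorphM /=; ring.
rewrite (dotE u) u1 rmorphB /=. by rewrite dot_conj; ring.
Qed.

End InnerProduct.

Arguments normsq {R}.
Arguments nrm2 {R n}.

(** * Local errors on a subspace with little weight on zeros in small sets *)

Section ErrorDetection.
Variables (R : realType) (n : nat).
Local Notation C := R[i].
Local Notation dot := (dinner R n).
Local Notation app := (opapp R n).
Local Notation Re := complex.Re.
Implicit Types (u v e phi : qstate R n) (F P : qop R n) (S : {set 'I_n}).

Definition ones_on S v : qstate R n :=
  fun x => if [disjoint zeros n x & S] then v x else 0.
Definition zero_in S v : qstate R n :=
  fun x => if [disjoint zeros n x & S] then 0 else v x.

Lemma nrm2_ones_on S v : nrm2 (ones_on S v) <= nrm2 v.
Proof.
apply: ler_sum => x _; rewrite /ones_on; case: ifP => // _.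
by rewrite {1}/normsq /= expr0n addr0 normsq_ge0.
Qed.

Lemma nrm2_zero_in S v : nrm2 (zero_in S v) <= nrm2 v.
Proof.
apply: ler_sum => x _; rewrite /zero_in; case: ifP => // _.
by rewrite {1}/normsq /= expr0n addr0 normsq_ge0.
Qed.

(** Strings that are all ones on [S] and agree off [S] are equal, so [F] is diagonal between strings
    without zeros in [S]; by locality every such diagonal entry equals the one at the all-ones
    string, which is [f]. *)
Lemma d_local_ones_on d F : d_local R n d F -> opnorm_le1 R n F ->
  exists S, #|S| = d /\ exists f : C, normsq f <= 1 /\
    forall v x, [disjoint zeros n x & S] -> app F (ones_on S v) x = f * v x.
Proof.
move=> [S [cS [G [Gloc FE]]]] F1; exists S; split=> //.
pose one : basis n := [ffun => true].
exists (G one one); split.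
  (* [f] is a coordinate of [F] applied to the all-ones unit vector, hence [|f| <= 1] by
     contraction. *)
  pose u : qstate R n := fun x => (x == one)%:R.
  have u1 : nrm2 u = 1.
    rewrite /nrm2 (bigD1 one) //= /u eqxx big1 => [|x /negPf ->];
      by rewrite /normsq /= ?expr0n ?expr1n /= ?addr0.
  have Fu : app F u one = G one one.
    rewrite /opapp (bigD1 one) //= /u eqxx mulr1 big1 => [|x /negPf ->];
      last by rewrite mulr0.
    by rewrite addr0 FE; case: forallP => // -[] i; rewrite eqxx implybT.
  rewrite -u1 -Fu; apply: le_trans (nrm2_app_le _ _ _ u F1).
  rewrite /nrm2 (bigD1 one) //= lerDl.
  by apply: sumr_ge0 => x _; exact: normsq_ge0.
move=> v x xS.
have onS y : [disjoint zeros n y & S] -> forall i, i \in S -> y i.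
  by move=> yS i iS; have := disjointFl yS iS; rewrite inE => /negbFE.
rewrite /opapp (bigD1 x) //= big1 => [|y yx].
  rewrite addr0 FE /ones_on xS; case: forallP => [_|[] i]; last by rewrite eqxx implybT.
  by congr (_ * _); apply: Gloc => i iS; rewrite !ffunE (onS x).
rewrite FE /ones_on; case: ifP => [/forallP xy|_]; last by rewrite mul0r.
case: ifP => [yS|_]; last by rewrite mulr0.
case/eqP: yx; apply/ffunP => i; have [iS|iS] := boolP (i \in S).
  by rewrite (onS y) // (onS x).
by have := xy i; rewrite iS => /eqP.
Qed.

(** With [g = F phi - f phi] and [e = P g], self-adjointness of [P] gives [|e|^2 = <e,g>]. On
    strings without zeros in [S], [g] is [F (zero_in S phi)]; on the others [e] has small weight,
    since [e] lies in [V] too. *)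
Lemma proj_error_le (V : qstate R n -> Prop) P d (Q : R) F phi :
  is_orth_proj_onto R n V P -> 0 < Q ->
  (forall S v, #|S| = d -> V v -> nrm2 (zero_in S v) <= Q * nrm2 v) ->
  d_local R n d F -> opnorm_le1 R n F -> V phi -> nrm2 phi = 1 ->
  nrm2 (app P (app F phi)) - normsq (dot phi (app P (app F phi))) <= 12 * Q.
Proof.
move=> [PP Padj PV Pid] Q0 VQ /d_local_ones_on Floc F1 Vphi phi1.
have [S [cS [f [f1 Fones]]]] := Floc F1.
apply: le_trans (nrm2_sub_proj_le _ _ _ _ f phi1) _.
pose g : qstate R n := fun x => app F phi x - f * phi x.
set e := (fun x => _ - _).
have eE : e = app P g.
  by apply/funext => x; rewrite /e /g opappB opappZ (Pid phi).
have Ve : V e by rewrite eE; exact: PV.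
pose h : qstate R n := fun x => - f * zero_in S phi x.
have split_e : dot e e = dot (zero_in S e) (app F phi) +
    dot (ones_on S e) (app F (zero_in S phi)) + dot (zero_in S e) h.
  transitivity (dot e g).
    rewrite {2}eE -[in RHS](_ : app P e = e); last first.
      by apply/funext => x; exact: Pid.
    rewrite dot_appl; congr (dinner _ _ _ _); congr (opapp _ _ _ _).
    by apply/funext => x; apply/funext => y; rewrite Padj.
  rewrite !dinnerE -!big_split /=; apply: eq_bigr => x _.
  have c0 : conjc (0 : C) = 0 by exact: conjc0.
  have phiE : phi = (fun y => ones_on S phi y - -1 * zero_in S phi y).
    by apply/funext => y; rewrite /ones_on /zero_in; case: ifP => _; ring.
  have [xS|xS] := boolP [disjoint zeros n x & S].
    have -> : zero_in S e x = 0 by rewrite /zero_in xS.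
    have -> : ones_on S e x = e x by rewrite /ones_on xS.
    by rewrite c0 /g {1}phiE opappB opappZ Fones //; ring.
  have -> : zero_in S e x = e x by rewrite /zero_in (negPf xS).
  have -> : ones_on S e x = 0 by rewrite /ones_on (negPf xS).
  by rewrite c0 /g /h {2}/zero_in (negPf xS); ring.
have zeQ := VQ S e cS Ve.
have zpQ := VQ S phi cS Vphi.
have ze := nrm2_zero_in S e.
have oe := nrm2_ones_on S e.
have Fphi := nrm2_app_le _ _ _ phi F1.
have Fz := nrm2_app_le _ _ _ (zero_in S phi) F1.
have hE : nrm2 h = normsq f * nrm2 (zero_in S phi).
  rewrite /nrm2 mulr_sumr; apply: eq_bigr => x _; rewrite /h normsqM.
  by congr (_ * _); case: (f) => a b; rewrite /normsq /= !sqrrN.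
have hQ : nrm2 h <= Q.
  rewrite hE; apply: le_trans (_ : nrm2 (zero_in S phi) <= _).
    by rewrite ler_piMl // nrm2_ge0.
  by rewrite phi1 mulr1 in zpQ.
(* With weights [(2Q)^-1], [1/2], [1/2], twice each of the three terms is at most [|e|^2/2 + 2Q].
   Hence [2|e|^2 <= 3|e|^2/2 + 6Q], which is the origin of the constant 12. *)
have s0 : 0 < (2 * Q)^-1 by rewrite invr_gt0 mulr_gt0.
have half : (0 : R) < 2^-1 by rewrite invr_gt0.
have := amgm_dot _ _ _ (zero_in S e) (app F phi) s0.
have := amgm_dot _ _ _ (ones_on S e) (app F (zero_in S phi)) half.
have := amgm_dot _ _ _ (zero_in S e) h half.
have zeQ' : (2 * Q)^-1 * nrm2 (zero_in S e) <= 2^-1 * nrm2 e.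
  by rewrite invfM -mulrA ler_pM2l // ler_pdivrMl.
rewrite !invrK (nrm2E _ _ e) split_e !ReD.
move: (nrm2E _ _ e); rewrite split_e !ReD.
rewrite phi1 in zpQ Fphi.
nra.
Qed.

Lemma channel_ketbraE (J : finType) (p : J -> R) (F : J -> qop R n) phi x y :
  channel R n J p F (ketbra R n phi phi) x y =
  \sum_j (p j)%:C%C * (app (F j) phi x * conjc (app (F j) phi y)).
Proof.
rewrite /channel; apply: eq_bigr => j _; congr (_ * _).
rewrite /opmul {2}/opapp rmorph_sum mulr_sumr; apply: eq_bigr => a _.
rewrite /adj rmorphM /=.
have -> : \sum_b F j x b * ketbra R n phi phi b a = app (F j) phi x * conjc (phi a).
  by rewrite /opapp mulr_suml; apply: eq_bigr => b _; rewrite mulrA.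
by ring.
Qed.

Lemma proj_approx_error_detect (V : qstate R n -> Prop) P d (Q delta : R)
    (J : finType) (p : J -> R) (F : J -> qop R n) :
  is_orth_proj_onto R n V P -> 0 < Q -> 0 < delta ->
  (forall S v, #|S| = d -> V v -> nrm2 (zero_in S v) <= Q * nrm2 v) ->
  (forall j, 0 <= p j) -> \sum_j p j = 1 ->
  (forall j, d_local R n d (F j)) -> (forall j, opnorm_le1 R n (F j)) ->
  approx_error_detect R n V P J p F (12 * Q / delta) delta.
Proof.
move=> VP Q0 delta0 VQ p0 p1 Floc F1 phi Vphi.
rewrite dotE => /complexI phi1 NPhi t delta_t.
pose rho : qop R n := fun x y => t^-1 * opmul R n (opmul R n P NPhi) P x y.
change (is_true ((1 - 12 * Q / delta)%:C%C <= dot phi (app rho phi))).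
have [PP Padj PV Pid] := VP.
have Pfun : opmul R n P P = P by do 2!apply/funext => ?; rewrite PP.
have adjfun : adj R n P = P by do 2!apply/funext => ?; rewrite Padj.
have Pphi : app P phi = phi by apply/funext => x; exact: Pid.
have PPu u : app P (app P u) = app P u.
  by apply/funext => x; rewrite -opapp_opmul Pfun.
have dotP u : dot phi (app P u) = dot phi u.
  by rewrite -[in RHS]Pphi dot_appl adjfun.
(* [T] is the probability of passing the projection and [T^-1 * D] the fidelity afterwards. As [T]
   and [D] are averages with the same weights [p], [proj_error_le] bounds [T - D] term by term. *)
pose T := \sum_j p j * nrm2 (app P (app (F j) phi)).
pose D := \sum_j p j * normsq (dot phi (app P (app (F j) phi))).
have tE : t = T%:C%C.
  rewrite /t /trace /opmul /=.
  rewrite /T (raddf_sum (real_complex R)) /=.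
  transitivity (\sum_x \sum_j \sum_y P x y *
      ((p j)%:C%C * (app (F j) phi y * conjc (app (F j) phi x)))).
    apply: eq_bigr => x _; rewrite exchange_big; apply: eq_bigr => y _ /=.
    by rewrite /NPhi channel_ketbraE mulr_sumr.
  rewrite exchange_big /=; apply: eq_bigr => j _.
  rewrite rmorphM /= -dotE dot_appl adjfun PPu dinnerE mulr_sumr.
  apply: eq_bigr => x _; rewrite {4}/opapp 2!mulr_sumr; apply: eq_bigr => y _.
  by ring.
have NE x : app NPhi phi x =
    \sum_j (p j)%:C%C * (app (F j) phi x * dot (app (F j) phi) phi).
  rewrite {1}/opapp; under eq_bigr do rewrite /NPhi channel_ketbraE mulr_suml.
  rewrite exchange_big /=; apply: eq_bigr => j _.
  by rewrite dinnerE 2!mulr_sumr; apply: eq_bigr => y _; ring.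
have DE : dot phi (app rho phi) = (T^-1 * D)%:C%C.
  have rhoE : app rho phi = fun x => t^-1 * app P (app NPhi phi) x.
    apply/funext => x; rewrite -{2}Pphi -2!opapp_opmul {2}/opapp mulr_sumr.
    by apply: eq_bigr => y _; rewrite mulrA.
  rewrite rhoE; transitivity (t^-1 * dot phi (app NPhi phi)).
    rewrite -[in RHS]dotP !dinnerE mulr_sumr.
    by apply: eq_bigr => x _; ring.
  rewrite rmorphM /= fmorphV tE; congr (_ * _).
  rewrite /D (raddf_sum (real_complex R)) /= dinnerE.
  under [LHS]eq_bigr do rewrite NE mulr_sumr.
  rewrite exchange_big /=; apply: eq_bigr => j _.
  rewrite rmorphM /= dotP normsqE dot_conj [in X in _ * (_ * X)]dinnerE 2!mulr_sumr.
  by apply: eq_bigr => x _; ring.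
have TD : T - D <= 12 * Q.
  rewrite -[12 * Q]mul1r -[X in _ <= X * _]p1 mulr_suml /T /D -sumrB; apply: ler_sum => j _.
  rewrite -mulrBr; apply: ler_wpM2l => //.
  exact: (proj_error_le V P d Q).
rewrite DE lecR.
move: delta_t; rewrite tE lecR => delta_T.
have T0 : 0 < T := lt_le_trans delta0 delta_T.
apply: (@le_trans _ _ (1 - 12 * Q / T)).
  by rewrite lerD2l lerN2 ler_pM2l ?mulr_gt0 // lef_pV2 ?posrE.
rewrite -(@ler_pM2l _ T) // mulrBr mulr1 mulrCA divff ?gt_eqF // mulr1.
by rewrite mulrA divff ?gt_eqF // mul1r; lra.
Qed.

End ErrorDetection.

(** * Weight of code states on strings with a zero in a given set; independence *)

Section DescendantCode.
Variables (R : realType) (n : nat).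
Local Notation C := R[i].
Local Notation w := (omega R n).
Implicit Types (v : qstate R n) (Rs : {set 'I_n.-1}) (S : {set 'I_n}).

(** The phase does not depend on [r], so translation acts as a scalar on the whole span. *)
Lemma in_desc_span_shift Rs v x :
  in_desc_span R n Rs v -> v (shift n x) = w * v x.
Proof.
move=> [c vE]; rewrite !vE mulr_sumr; apply: eq_bigr => r _.
by rewrite descendant_shift mulrCA.
Qed.

Lemma in_desc_span_eq0 Rs v M x : (forall r, r \in Rs -> (r < M)%N) ->
  in_desc_span R n Rs v -> (M < #|zeros n x|)%N -> v x = 0.
Proof.
move=> RsM [c vE] xM; rewrite vE big1 // => r /RsM rM.
(* The descendant of index [r] lives on exactly [r+1] zeros, and [r < M] gives [r+1 <= M]. *)
by rewrite descendantE gtn_eqF ?mulr0 // (leq_ltn_trans rM).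
Qed.

Lemma normsq_omega : normsq w = 1.
Proof. by rewrite /normsq /= cos2Dsin2. Qed.

Lemma desc_zero_in_le Rs v M S : (forall r, r \in Rs -> (r < M)%N) ->
  in_desc_span R n Rs v ->
  nrm2 (zero_in R n S v) <= (#|S| * M)%:R / n%:R * nrm2 v.
Proof.
move=> RsM Vv.
pose A i := \sum_(x | i \in zeros n x) normsq (v x).
have AS i : A (ordS i) = A i.
  rewrite /A (reindex (shift n)) /=; last exact/onW_bij/shift_bij.
  apply: eq_big => [x|x _].
    by rewrite zeros_shift mem_imset //; exact: ordS_inj.
  by rewrite (in_desc_span_shift Rs) // normsqM normsq_omega mul1r.
(* Induction on the larger index, so that the successor never wraps around. *)
have Aconst i j : A i = A j.
  wlog: i j / (i <= j)%N.
    by move=> H; have [/H|/ltnW /H ->] := leqP i j.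
  case: j => j jn /=; elim: j jn => [|j IH] jn ij.
    by congr A; apply: val_inj; move: ij; rewrite leqn0 => /eqP.
  move: ij; rewrite leq_eqVlt => /predU1P[ij|]; first by congr A; exact: val_inj.
  rewrite ltnS => /(IH (ltnW jn)) ->; rewrite -AS; congr A.
  by apply: val_inj => /=; rewrite modn_small.
(* Double counting: a string contributes once per zero, and its amplitude vanishes beyond [M]
   zeros. *)
have sumA : \sum_i A i <= M%:R * nrm2 v.
  rewrite /A (exchange_big_dep predT) //= mulr_sumr; apply: ler_sum => x _.
  rewrite sumr_const -[leLHS]mulr_natl.
  have [xM|xM] := leqP #|zeros n x| M.
    by rewrite ler_wpM2r ?normsq_ge0 // ler_nat.
  by rewrite (in_desc_span_eq0 Rs v M) // /normsq /= expr0n addr0 !mulr0.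
(* Union bound over the sites of [S]. *)
have zA : nrm2 (zero_in R n S v) <= \sum_(i in S) A i.
  rewrite /A (exchange_big_dep predT) //=; apply: ler_sum => x _.
  rewrite /zero_in; case: ifPn => [_|].
    rewrite {1}/normsq /= expr0n addr0.
    by apply: sumr_ge0 => i _; exact: normsq_ge0.
  rewrite -setI_eq0 => /set0Pn[j]; rewrite inE => /andP[jx jS].
  rewrite (bigD1 j) /=; last by rewrite jS.
  by rewrite lerDl; apply: sumr_ge0 => i _; exact: normsq_ge0.
apply: le_trans zA _.
(* A site in [S] yields [n > 0], needed to divide by [n]; for empty [S] both sides vanish. *)
have [->|/set0Pn[i0 _]] := eqVneq S set0.
  by rewrite big_set0 cards0 mul0n !mul0r.
have n0 : 0 < n%:R :> R by rewrite ltr0n (leq_trans _ (ltn_ord i0)).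
rewrite (eq_bigr (fun=> A i0)) // sumr_const -[leLHS]mulr_natl natrM -!mulrA.
rewrite ler_wpM2l // ?ler0n // mulrCA ler_pdivlMl //.
rewrite (eq_bigr (fun=> A i0)) // sumr_const card_ord in sumA.
by rewrite mulr_natl.
Qed.

(** The number of zeros determines [r], so distinct descendants have disjoint supports and
    evaluation at one string isolates [c r]. *)
Lemma desc_indep Rs : (2 < n)%N -> desc_lin_indep R n Rs.
Proof.
move=> n2 c c0 r rRs.
have rn : (r.+1 < n)%N by rewrite -ltn_predRL ltn_ord.
have [x [xr dx]] := descendant_neq0 R n r n2 rn.
have := c0 x; rewrite (bigD1 r) //= big1 ?addr0 => [/eqP|s /andP[_ sr]].
  by rewrite mulf_eq0 (negPf dx) orbF => /eqP.
by rewrite descendantE xr eqSS eq_sym (_ : (s == r :> nat) = false) ?mulr0 //; exact/negbTE.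
Qed.

End DescendantCode.

(** * Size of the code and choice of parameters *)

Section CodeSize.
Variables (R : realType).

Lemma pow2_truncn_le (kappa : R) n : 0 <= kappa -> (0 < n)%N ->
  (2 ^ Num.truncn (kappa * log2 R n%:R))%:R <= n%:R `^ kappa :> R.
Proof.
move=> k0 n0.
have ln2 : 0 < ln 2 :> R by rewrite ln_gt0 ?ltr1n.
have lnn : 0 <= ln n%:R :> R by rewrite ln_ge0 ?ler1n.
have nR : n%:R != 0 :> R by rewrite pnatr_eq0 -lt0n.
rewrite natrX -powR_mulrn // /powR (negPf nR) pnatr_eq0 /= ler_expR.
rewrite -ler_pdivlMr // -mulrA truncn_le // mulr_ge0 // divr_ge0 //.
exact: ltW.
Qed.

(** Parity separates the indices by 2, and the largest, [2m - 2], fits in ['I_n.-1] once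
    [2m <= n]. *)
Definition even_code n (m : nat) : {set 'I_n.-1} := [set r : 'I_n.-1 | ~~ odd r & (r < m.*2)%N].

Lemma card_even_code n m : (m.*2 <= n)%N -> #|even_code n m| = m.
Proof.
move=> mn.
have lt (j : 'I_m) : (j.*2 < n.-1)%N.
  by move: mn; have := ltn_ord j; rewrite -leq_double; lia.
suff -> : even_code n m = [set Ordinal (lt j) | j in [set: 'I_m]].
  rewrite card_imset ?cardsT ?card_ord // => i j /(congr1 val) /= /double_inj.
  exact: val_inj.
apply/setP => r; rewrite inE; apply/andP/imsetP => [[ev rm]|[j _ ->]].
  have hm : (r./2 < m)%N by rewrite -ltn_double even_halfK.
  by exists (Ordinal hm); rewrite ?inE //; apply: val_inj; rewrite /= even_halfK.
by rewrite /= odd_double ltn_double.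
Qed.

End CodeSize.

Theorem theorem8 (R : realType) (nu kappa lambda : R) :
  0 < nu < 1 -> 0 < lambda -> 0 < kappa -> 6 * kappa + lambda < nu ->
  exists c1 c2 : R, 0 < c1 /\ 0 < c2 /\
  exists N0 : nat, forall n : nat, (N0 <= n)%N ->
    exists Rs : {set 'I_n.-1},
      mag_sep2 n Rs /\
      exists eps : R,
        c1 * n%:R `^ (- (nu - (6 * kappa + lambda))) <= eps <=
          c2 * n%:R `^ (- (nu - (6 * kappa + lambda))) /\
        desc_AQEDC R n
          (Num.truncn (kappa * log2 R n%:R))        (* k = kappa log2 n *)
          (Num.truncn (n%:R `^ (1 - nu)))         (* d = n^(1-nu) *)
          eps (n%:R `^ (- lambda))                (* delta = n^(-lambda) *)
          Rs.
Proof.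
move=> /andP[nu0 nu1] l0 k0 kln.
(* The [eps] chosen below is exactly [24 = 12 * 2] times the required power of [n], so both
   constants agree. The threshold 4 gives [sqrt n >= 2]. *)
exists 24, 24; do 2 (split=> //); exists 4 => n n4.
have n0 : (0 < n)%N by apply: leq_trans n4.
have nR0 : 0 < n%:R :> R by rewrite ltr0n.
have nR1 : 1 <= n%:R :> R by rewrite ler1n.
have nRD r s : n%:R `^ (r + s) = n%:R `^ r * n%:R `^ s :> R.
  by rewrite powRD // (gt_eqF nR0) implybT.
set k := Num.truncn _; set d := Num.truncn _.
have k_le : (2 ^ k)%:R <= n%:R `^ kappa :> R by apply: pow2_truncn_le => //; exact: ltW.
have d_le : d%:R <= n%:R `^ (1 - nu) :> R by rewrite truncn_le // powR_ge0.
have sqrt_ge2 : 2 <= n%:R `^ (2^-1) :> R.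
  rewrite powR12_sqrt ?ler0n // -[2]ger0_norm // -sqrtr_sqr ler_sqrt ?ler0n //.
  by rewrite -natrX ler_nat.
(* From [6 kappa < nu < 1] follows [kappa < 1/2], so [2 * 2^k <= sqrt n * sqrt n]. *)
have mn : ((2 ^ k).*2 <= n)%N.
  rewrite -(ler_nat R) -muln2 natrM.
  have -> : n%:R = n%:R `^ (2^-1) * n%:R `^ (2^-1) :> R.
    by rewrite -nRD (_ : 2^-1 + 2^-1 = 1) ?powRr1 ?ler0n //; field.
  apply: ler_pM => //.
  by apply: le_trans k_le _; apply: ler_powR => //; lra.
exists (even_code n (2 ^ k)); split.
  move=> r r'; rewrite !inE => /andP[ev _] /andP[ev' _] rr'.
  have : (r != r' :> nat) by [].
  by lia.
(* Counting gives [2 n^(kappa - nu)]; the exponent is enlarged to [6 kappa - nu] so that [eps] has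
   exactly the prescribed order. *)
pose Q : R := 2 * n%:R `^ (6 * kappa - nu).
have Q0 : 0 < Q by rewrite mulr_gt0 ?powR_gt0.
have delta0 : 0 < n%:R `^ (- lambda) :> R by rewrite powR_gt0.
exists (12 * Q / n%:R `^ (- lambda)); split.
  have -> : 12 * Q / n%:R `^ (- lambda) =
      24 * n%:R `^ (- (nu - (6 * kappa + lambda))) :> R.
    rewrite -powRN opprK /Q !mulrA -mulrA -nRD -natrM.
    by congr (_ * _ `^ _); ring.
  by rewrite lexx.
split; [exact: card_even_code | by apply: desc_indep; apply: leq_trans n4 |].
move=> P VP J p F p0 p1 Floc F1 _.
apply: (@proj_approx_error_detect R n _ P d) => // S v Sd Vv.
apply: le_trans (desc_zero_in_le R n _ v (2 ^ k).*2 S _ Vv) _.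
  by move=> r; rewrite inE => /andP[].
rewrite ler_wpM2r ?nrm2_ge0 // Sd natrM -muln2 natrM ler_pdivrMr //.
(* Factors are matched: [d] against [n^(1 - nu)], and [2^k * 2] against [n^(6 kappa) * 2]. *)
have -> : Q * n%:R = n%:R `^ (1 - nu) * (n%:R `^ (6 * kappa) * 2).
  rewrite /Q -[X in _ * X = _](powRr1 (ltW nR0)) -mulrA -nRD mulrA -nRD mulrC.
  by congr (_ `^ _ * _); ring.
apply: ler_pM; rewrite ?ler0n ?mulr_ge0 ?ler0n //.
rewrite ler_pM2r //; apply: le_trans k_le _; apply: ler_powR => //; lra.
Qed.
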